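(* Let $C\subset\mathbb{P}^n$ be a rational normal curve. Then, for each $k=1,\dots,\lfloor n/2\rfloor$, the Hilbert series of $\operatorname{Sec}_kC\subset\mathbb{P}^n$ is $$h_{\operatorname{Sec}_kC}(t)=\frac{\sum_{j=0}^{k}\binom{n-2k+j}{j}t^j}{(1-t)^{2k}}=\frac{1+\binom{n-2k+1}{1}t+\binom{n-2k+2}{2}t^2+\dots+\binom{n-k}{k}t^k}{(1-t)^{2k}} .$$
   Context: We work over $\mathbb{C}$. A rational normal curve $C\subset\mathbb{P}^n$ is a curve projectively equivalent to the image of the degree-$n$ Veronese embedding $\mathbb{P}^1\to\mathbb{P}^n$. $\operatorname{Sec}_kC$ is the closure of the union of the $(k-1)$-planes spanned by $k$ general points of $C$ (with its reduced structure). The Hilbert series of a projective scheme $X\subset\mathbb{P}^n$ is the Hilbert series $h_X(t)$ of its homogeneous coordinate ring. *)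

(* Defs.v *)
From HB Require Import structures.
From mathcomp Require Import all_boot all_order all_algebra.
From mathcomp Require Import boolp classical_sets.
From mathcomp Require Import mpoly.

Set Implicit Arguments.
Unset Strict Implicit.
Unset Printing Implicit Defensive.

Import GRing.Theory.

Local Open Scope classical_set_scope.
Local Open Scope ring_scope.

(** ** Projective space *)

(* Points are lines through the origin of K^(n+1). *)
Definition proj_space (K : fieldType) (n : nat) : Type :=
  {L : {vspace 'rV[K]_n.+1} | \dim L == 1%N}.

Section ProjectiveSets.
Variables (K : closedFieldType) (n : nat).
Implicit Types (x y : proj_space K n) (X C : set (proj_space K n)).

(* Vanishing at every representative of x. Since K is infinite, this amounts
   to the vanishing at x of every homogeneous component of F. *)
Definition vanishes_at (F : {mpoly K[n.+1]}) x : Prop :=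
  forall v : 'rV[K]_n.+1, v \in val x -> F.@[v 0] = 0.

Definition vanishes_on (F : {mpoly K[n.+1]}) X : Prop :=
  forall x, X x -> vanishes_at F x.

Definition zariski_closure X : set (proj_space K n) :=
  [set x | forall (d : nat) (F : dhomog n.+1 K d),
     vanishes_on F X -> vanishes_at F x].

(** ** Rational normal curves *)

Definition veronese (u : 'rV[K]_2) : 'rV[K]_n.+1 :=
  \row_(i < n.+1) (u 0 0 ^+ (n - i) * u 0 1 ^+ i).

Definition veronese_curve : set (proj_space K n) :=
  [set x | exists2 u : 'rV[K]_2, u != 0 & val x = <[veronese u]>%VS].

Definition rational_normal_curve C : Prop :=
  exists2 g : 'M[K]_n.+1, g \in unitmx &
    C = [set x | exists2 y, veronese_curve y &
                   val x = (linfun (mulmxr g) @: val y)%VS].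

(** ** Secant varieties *)

Definition cartesian_power k C : set ('I_k -> proj_space K n) :=
  [set p : 'I_k -> proj_space K n | forall i, C (p i)].

(* The closed subset of (P^n)^k defined by T, the i-th block of n+1 variables
   holding the coordinates of the i-th point. As for [vanishes_at], requiring
   F to vanish at all choices of representatives is requiring all its
   multihomogeneous components to vanish, so T need not be multihomogeneous. *)
Definition multi_zeros k (T : set {mpoly K[k * n.+1]}) :
    set ('I_k -> proj_space K n) :=
  [set p : 'I_k -> proj_space K n |
     forall F, T F -> forall A : 'M[K]_(k, n.+1),
     (forall i, row i A \in val (p i)) -> F.@[mxvec A 0] = 0].

Definition open_in_power k C (U : set ('I_k -> proj_space K n)) : Prop :=
  exists T, U = cartesian_power C `\` multi_zeros T.

Definition secant_plane k (p : 'I_k -> proj_space K n) : set (proj_space K n) :=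
  [set x | (val x <= \sum_(i < k) val (p i))%VS].

(* The closure of the union of the planes spanned by k general points of C.
   When C is irreducible, the nonempty open subsets U of C^k are dense and
   form a filter base, and the closures below decrease with U; by
   noetherianity their intersection is the closure obtained from any
   sufficiently small U. *)
Definition secant_variety k C : set (proj_space K n) :=
  \bigcap_(U in [set U : set ('I_k -> proj_space K n) | @open_in_power k C U /\ U !=set0])
    zariski_closure (\bigcup_(p in U) secant_plane p).

(** ** Hilbert series *)

Lemma vanishing_forms_subproof X d :
  exists W : {vspace dhomog n.+1 K d}, forall F, F \in W <-> vanishes_on F X.
Proof.
pose P m := `[< exists2 W : {vspace dhomog n.+1 K d},
  (forall F, F \in W -> vanishes_on F X) & \dim W = m >].
have exP : exists m, P m.
  exists 0%N; apply/asboolP; exists 0%VS; last by rewrite dimv0.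
  by move=> F; rewrite memv0 => /eqP -> x _ v _; rewrite meval0.
have ubP m : P m -> (m <= \dim {: dhomog n.+1 K d})%N.
  by case/asboolP=> W _ <-; rewrite dimvS ?subvf.
case: (ex_maxnP exP ubP) => m /asboolP[W WX dimW] maxW.
exists W => F; split=> [/WX//|FX].
suff /eqP eqW : W == (W + <[F]>)%VS.
  by rewrite eqW; apply: (subvP (addvSr W <[F]>)); rewrite memv_line.
rewrite eqEdim addvSl /= dimW; apply: maxW; apply/asboolP.
exists (W + <[F]>)%VS => // G /memv_addP[G1 /WX G1X [_ /vlineP[c ->] ->]] x Xx v xv.
by rewrite /= mevalD mevalZ (G1X x Xx v xv) (FX x Xx v xv) mulr0 addr0.
Qed.

(* The degree d part of the homogeneous ideal of X. *)
Definition vanishing_forms X d : {vspace dhomog n.+1 K d} :=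
  sval (cid (vanishing_forms_subproof X d)).

Lemma vanishing_formsP X d (F : dhomog n.+1 K d) :
  F \in vanishing_forms X d <-> vanishes_on F X.
Proof. exact: (svalP (cid (vanishing_forms_subproof X d))). Qed.

(* The dimension of the degree d part S_d / I(X)_d of the homogeneous
   coordinate ring of X. *)
Definition hilbert_function X (d : nat) : nat :=
  \dim {: dhomog n.+1 K d} - \dim (vanishing_forms X d).

End ProjectiveSets.

(* Formal power series with integer coefficients. *)
Definition power_series : Type := nat -> int.

Definition series_mul (f g : power_series) : power_series :=
  fun d => \sum_(i < d.+1) f i * g (d - i)%N.

Definition series_of_poly (p : {poly int}) : power_series := fun d => p`_d.

(* f = p / q in Z[[t]]; for q != 0 there is at most one such f, as Z[[t]] is
   a domain. *)
Definition series_is_fraction (f : power_series) (p q : {poly int}) : Prop :=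
  series_mul f (series_of_poly q) = series_of_poly p.

Definition hilbert_series (K : closedFieldType) (n : nat)
    (X : set (proj_space K n)) : power_series :=
  fun d => (hilbert_function X d)%:Z.

(* Main.v *)
From HB Require Import structures.
Require Import Defs.
From mathcomp Require Import all_boot all_order all_algebra all_fingroup.
From mathcomp Require Import boolp classical_sets reals.
From mathcomp Require Import complex.
From mathcomp Require Import mpoly.
From mathcomp Require Import zify ring.

(* A form vanishes on Sec_k C iff it vanishes at all sums of k points of the
   affine cone over C, so its ideal contains the (k+1)-minors of the Hankel
   (catalecticant) matrices. Their leading terms are the monomials
   x_(i_0) ... x_(i_k) with gaps i_(c+1) - i_c >= 2; hence the standard
   monomials, whose support contains no such chain, span the coordinate ring.
   They are also linearly independent: if F is standard, nonzero and vanishes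
   on Sec_k C, let one of the k points tend to the coordinate point e_n on C;
   the leading coefficient of F in x_n then vanishes on the join of e_(n-1) and
   Sec_(k-1), and its coefficients with respect to x_(n-1) are standard for the
   curve of degree n - 2 and k - 1, so that induction applies. The same
   decomposition gives the recursion
     h(n, k) = h(n - 1, k) + t / (1 - t)^2 * h(n - 2, k - 1)
   for the generating series of the standard monomials, which is Pascal's rule
   for the numerators. *)

Set Implicit Arguments.
Unset Strict Implicit.
Unset Printing Implicit Defensive.

Import GRing.Theory.

Local Open Scope ring_scope.

(** * Counting standard monomials *)

(* Exponent vectors are listed with the last variable first. This is the
   greedily computed, hence largest, number of variables that occur and have
   pairwise index differences at least 2. *)
Fixpoint chain_number (s : seq nat) : nat :=
  match s with
  | [::] => 0
  | 0%N :: s' => chain_number s'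
  | e.+1 :: [::] => 1
  | e.+1 :: _ :: s' => (chain_number s').+1
  end.

Fixpoint exponents (N d : nat) : seq (seq nat) :=
  if N is N'.+1
  then flatten [seq [seq e :: s | s <- exponents N' (d - e)] | e <- iota 0 d.+1]
  else if d == 0%N then [:: [::]] else [::].

Lemma exponentsS N d : exponents N.+1 d =
  flatten [seq [seq e :: s | s <- exponents N (d - e)] | e <- iota 0 d.+1].
Proof. by []. Qed.

Arguments exponents : simpl never.

Lemma mem_exponents N d s :
  (s \in exponents N d) = (size s == N) && (sumn s == d).
Proof.
elim: N d s => [|N IH] d s; first by case: d s => [|d] [|e s].
rewrite exponentsS; apply/flatten_mapP/andP => [[e +] /mapP[s' +] ->|].
  by rewrite IH mem_iota ltnS => led /andP[/eqP sN /eqP sd] /=; rewrite sN sd subnKC.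
case: s => [|e s] [] // /eqP[sN] /eqP sd.
exists e; first by rewrite mem_iota ltnS -sd /= leq_addr.
by apply/mapP; exists s => //; rewrite IH -sd /= addKn sN !eqxx.
Qed.

Lemma exponents_uniq N d : uniq (exponents N d).
Proof.
elim: N d => [|N IH] d; first by case: d.
rewrite exponentsS.
apply: (@allpairs_uniq_dep _ _ _ cons (iota 0 d.+1) (fun e => exponents N (d - e))).
- exact: iota_uniq.
- by move=> e _; apply: IH.
- by move=> [e s] [f t] _ _ [-> ->].
Qed.

Definition standard_count (N k d : nat) : nat :=
  count (fun s => chain_number s <= k)%N (exponents N d).

Lemma count_exponentsS (P : pred (seq nat)) N d :
  count P (exponents N.+1 d) =
  (\sum_(e < d.+1) count (fun s => P (nat_of_ord e :: s)) (exponents N (d - e)))%N.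
Proof.
rewrite exponentsS count_flatten -map_comp sumnE big_map.
rewrite -(big_mkord xpredT (fun e => count (fun s => P (e :: s)) (exponents N (d - e)))).
rewrite /index_iota subn0.
by apply: eq_bigr => e _ /=; rewrite count_map.
Qed.

(** Multiplication by t on power series; [sum_series] and [diff_series] below are multiplication by
    1/(1 - t) and by 1 - t. *)
Definition shift_series (f : power_series) : power_series :=
  fun d => if d is d'.+1 then f d' else 0.

Definition sum_series (f : power_series) : power_series :=
  fun d => \sum_(e < d.+1) f (d - e)%N.

Definition diff_series (f : power_series) : power_series :=
  fun d => f d - shift_series f d.

Definition standard_series N k : power_series := fun d => (standard_count N k d)%:Z.

Lemma sum_seriesK : cancel sum_series diff_series.
Proof.
move=> f; apply/funext => -[|d]; rewrite /diff_series /sum_series /=.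
  by rewrite big_ord_recl big_ord0 subn0 addr0 subr0.
rewrite big_ord_recl subn0 /= -addrA (eq_bigr (fun i : 'I_d.+1 => f (d - i)%N)).
  by rewrite subrr addr0.
by move=> i _; rewrite subSS.
Qed.

Lemma diff_shift f : diff_series (shift_series f) = shift_series (diff_series f).
Proof. by apply/funext => -[|d] //=; rewrite /diff_series /= ?subrr. Qed.

Lemma diff_seriesD f g : diff_series (fun d => f d + g d) =
  (fun d => diff_series f d + diff_series g d).
Proof. by apply/funext => -[|d]; rewrite /diff_series /=; ring. Qed.

Lemma iter_diff_seriesD m f g : iter m diff_series (fun d => f d + g d) =
  (fun d => iter m diff_series f d + iter m diff_series g d).
Proof. by elim: m => //= m ->; rewrite diff_seriesD. Qed.

Lemma iter_diff_shift m f :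
  iter m diff_series (shift_series f) = shift_series (iter m diff_series f).
Proof. by elim: m => //= m ->; rewrite diff_shift. Qed.

Lemma standard_series_k0 N : standard_series N 0 = (fun d => (d == 0%N)%:R).
Proof.
rewrite /standard_series /standard_count.
elim: N => [|N IH]; apply/funext => d; first by case: d.
rewrite count_exponentsS big_ord_recl big1 => [|i _]; last first.
  by rewrite -[RHS](count_pred0 (exponents N (d - lift ord0 i))); apply: eq_count => -[|? ?].
by rewrite /= subn0 addn0 -(congr1 (fun f => f d) IH).
Qed.

Lemma standard_series_0k k : standard_series 0 k = (fun d => (d == 0%N)%:R).
Proof. by apply/funext => -[]. Qed.

Lemma standard_series_1k k : standard_series 1 k.+1 = sum_series (standard_series 0 k).
Proof.
apply/funext => d; rewrite /standard_series /sum_series /standard_count.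
rewrite count_exponentsS -natz natr_sum; apply: eq_bigr => e _.
rewrite natz; congr Posz; apply: eq_in_count => s.
by rewrite mem_exponents => /andP[/eqP/size0nil-> _]; case: (nat_of_ord e).
Qed.

(* Split off the last variable; when it occurs, the one before it is free. *)
Lemma standard_seriesSS N k : standard_series N.+2 k.+1 =
  (fun d => standard_series N.+1 k.+1 d +
            shift_series (sum_series (sum_series (standard_series N k))) d).
Proof.
apply/funext => d; rewrite /standard_series {1}/standard_count.
rewrite count_exponentsS big_ord_recl PoszD /= subn0; congr (_ + _).
rewrite -natz natr_sum; case: d => [|d]; first by rewrite big_ord0.
apply: eq_bigr => i _ /=; rewrite natz /bump leq0n add1n subSS.
rewrite count_exponentsS -natz natr_sum; apply: eq_bigr => e _.
by rewrite natz.
Qed.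

Lemma iter_diff_standard_seriesSS N k m :
  iter m.+2 diff_series (standard_series N.+2 k.+1) =
  (fun d => iter m.+2 diff_series (standard_series N.+1 k.+1) d +
            shift_series (iter m diff_series (standard_series N k)) d).
Proof.
by rewrite standard_seriesSS iter_diff_seriesD iter_diff_shift !iterSr !sum_seriesK.
Qed.

(** A chain with gaps at least 2 among N variables has at most N/2 members, rounded up, hence at
    most k. So every monomial is standard and the series is 1/(1 - t)^N. *)
Lemma iter_diff_standard_small N k : (N <= 2 * k)%N ->
  iter N diff_series (standard_series N k) = (fun d => (d == 0%N)%:R).
Proof.
elim/ltn_ind: N k => -[|[|N]] IH [|k] // leN.
- exact: standard_series_0k.
- exact: standard_series_0k.
- by rewrite standard_series_1k /= sum_seriesK standard_series_0k.
(* The two terms of the recursion contribute 1 - t and t, whose sum is 1. *)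
rewrite iter_diff_standard_seriesSS iterS !IH; [|lia..].
by apply/funext => -[|[|d]]; rewrite /diff_series /=.
Qed.

(** Induction on N with base cases N = 2k, where all monomials are standard and the numerator is 1,
    and k = 0. Otherwise the recursion times (1 - t)^(2k) is Pascal's rule in each degree. *)
Lemma iter_diff_standard_series N k : (2 * k <= N)%N ->
  iter (2 * k) diff_series (standard_series N k) =
  (fun d => if (d <= k)%N then ('C(N + d - (2 * k).+1, d))%:R else 0).
Proof.
elim/ltn_ind: N k => N IH k leN.
have [eN|ltN] := eqVneq N (2 * k)%N.
  rewrite -{1}eN iter_diff_standard_small ?eN //; apply/funext => -[|d] /=; first by rewrite bin0.
  by rewrite bin_small ?if_same //; lia.
case: k => [|k] in IH leN ltN *.
  by rewrite /= standard_series_k0; apply/funext => -[|d] //=; rewrite bin0.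
case: N => [|[|N]] // in IH leN ltN *; first by lia.
rewrite (_ : 2 * k.+1 = (2 * k).+2)%N; last by lia.
rewrite iter_diff_standard_seriesSS (_ : (2 * k).+2 = 2 * k.+1)%N; last by lia.
rewrite !IH; try lia.
apply/funext => -[|d] /=; first by rewrite !bin0 addr0.
rewrite ltnS; case: ifP => _; last by rewrite addr0.
(* The equality case is already settled, so [N] exceeds [2 * k] and the upper index is a successor,
   as Pascal's rule requires. *)
rewrite (_ : N.+2 + d.+1 - (2 * k.+1).+1 = (N + d - 2 * k).-1.+1)%N; last by lia.
rewrite binS natrD; congr (_%:R + _%:R); congr 'C(_, _); lia.
Qed.

(** * Multiplying a series by powers of 1 - X *)

Lemma series_mul_subX f (p : {poly int}) :
  series_mul f (series_of_poly (p * (1 - 'X))) =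
  diff_series (series_mul f (series_of_poly p)).
Proof.
have eqS d : series_mul f (series_of_poly p) d = \sum_(i < d.+1) f i * p`_(d - i) by [].
apply/funext => d; rewrite /series_mul /series_of_poly /diff_series.
transitivity (\sum_(i < d.+1) f i * p`_(d - i) -
  \sum_(i < d.+1) f i * (if (d - i)%N == 0%N then 0 else p`_(d - i).-1)).
  rewrite -sumrB; apply: eq_bigr => i _.
  by rewrite mulrBr mulr1 coefB coefMX mulrBr.
congr (_ - _); case: d => [|d]; first by rewrite big_ord1 mulr0.
rewrite big_ord_recr /= subnn mulr0 addr0; apply: eq_bigr => i _.
by rewrite subn_eq0 leqNgt ltnS leq_ord /= subSn ?leq_ord.
Qed.

Lemma series_mul_subXn f m :
  series_mul f (series_of_poly ((1 - 'X) ^+ m)) = iter m diff_series f.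
Proof.
elim: m => [|m IH]; last by rewrite exprSr series_mul_subX IH.
apply/funext => d; rewrite /series_mul /series_of_poly big_ord_recr /= subnn.
rewrite big1 ?add0r => [|i _]; first by rewrite expr0 coef1 mulr1.
by rewrite expr0 coef1 subn_eq0 leqNgt ltn_ord mulr0.
Qed.

Lemma standard_series_fraction n k : (2 * k <= n)%N ->
  series_is_fraction (standard_series n.+1 k)
    (\sum_(0 <= j < k.+1) ('C(n - 2 * k + j, j)%:R *: 'X^j))
    ((1 - 'X) ^+ (2 * k)).
Proof.
move=> len; rewrite /series_is_fraction series_mul_subXn.
rewrite iter_diff_standard_series; last by lia.
apply/funext => d; rewrite /series_of_poly coef_sum.
rewrite (eq_bigr (fun j : nat => if j == d then ('C(n - 2 * k + d, d))%:R else 0)); last first.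
  move=> j _; rewrite coefZ coefXn eq_sym; case: eqP => [->|_]; by rewrite ?mulr1 ?mulr0.
rewrite -big_mkcond big_nat1_eq leq0n ltnS.
case: ifP => // _; rewrite (_ : n.+1 + d - (2 * k).+1 = n - 2 * k + d)%N //; lia.
Qed.

(** * Linear independence of the standard monomials *)

Definition polynomial_function (K : nzRingType) (f : K -> K) : Prop :=
  exists p : {poly K}, forall t, f t = p.[t].

Section PolynomialFunctions.
Variable K : closedFieldType.
Implicit Types f g : K -> K.

Lemma polyfun_cst (a : K) : polynomial_function (fun _ : K => a).
Proof. by exists a%:P => t; rewrite hornerC. Qed.

Lemma polyfun_id : polynomial_function (fun t : K => t).
Proof. by exists 'X => t; rewrite hornerX. Qed.

Lemma polyfunD f g : polynomial_function f -> polynomial_function g ->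
  polynomial_function (fun t => f t + g t).
Proof. by move=> [p fp] [q gq]; exists (p + q) => t; rewrite hornerD fp gq. Qed.

Lemma polyfunM f g : polynomial_function f -> polynomial_function g ->
  polynomial_function (fun t => f t * g t).
Proof. by move=> [p fp] [q gq]; exists (p * q) => t; rewrite hornerM fp gq. Qed.

Lemma polyfunX f m : polynomial_function f ->
  polynomial_function (fun t => f t ^+ m).
Proof. by move=> [p fp]; exists (p ^+ m) => t; rewrite horner_exp fp. Qed.

Lemma polyfun_sum (I : Type) (r : seq I) (F : I -> K -> K) :
  (forall i, polynomial_function (F i)) ->
  polynomial_function (fun t => \sum_(i <- r) F i t).
Proof.
move=> Fp; elim: r => [|i r IH].
  by have [p e] := polyfun_cst 0; exists p => t; rewrite big_nil -e.
by have [p e] := polyfunD (Fp i) IH; exists p => t; rewrite big_cons -e.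
Qed.

Lemma polyfun_prod (I : Type) (r : seq I) (F : I -> K -> K) :
  (forall i, polynomial_function (F i)) ->
  polynomial_function (fun t => \prod_(i <- r) F i t).
Proof.
move=> Fp; elim: r => [|i r IH].
  by have [p e] := polyfun_cst 1; exists p => t; rewrite big_nil -e.
by have [p e] := polyfunM (Fp i) IH; exists p => t; rewrite big_cons -e.
Qed.

Lemma polyfun_meval n (F : {mpoly K[n]}) (x : K -> 'I_n -> K) :
  (forall i, polynomial_function (x^~ i)) ->
  polynomial_function (fun t => F.@[x t]).
Proof.
move=> xp; suff [p e] : polynomial_function
    (fun t => \sum_(m <- msupp F) F@_m * \prod_i x t i ^+ m i).
  by exists p => t; rewrite mevalE -e.
apply: polyfun_sum => m; apply: polyfunM; first exact: polyfun_cst.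
by apply: polyfun_prod => i; apply/polyfunX/xp.
Qed.

Lemma poly_eq0_horner (p : {poly K}) : (forall t, p.[t] = 0) -> p = 0.
Proof.
move=> p0; apply/eqP; apply: contraT => /closed_nonrootP[t].
by rewrite /root p0 eqxx.
Qed.

(** The product of the two polynomials vanishes everywhere, so it is zero because K is infinite;
    K[X] is a domain and the second factor is nonzero. *)
Lemma polyfun_eq0 f g t0 : polynomial_function f -> polynomial_function g ->
  g t0 != 0 -> (forall t, g t != 0 -> f t = 0) -> forall t, f t = 0.
Proof.
move=> [p fp] [q gq] gt0 f0 t.
suff /eqP : p * q = 0.
  rewrite mulf_eq0 => /orP[] /eqP p0; first by rewrite fp p0 horner0.
  by rewrite gq p0 horner0 eqxx in gt0.
apply: poly_eq0_horner => u; rewrite hornerM -fp -gq.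
by have [->|/f0->] := eqVneq (g u) 0; rewrite ?mulr0 ?mul0r.
Qed.

(** The algebraic substitute for a limit t -> s. *)
Lemma polyfun_punctured f s : polynomial_function f ->
  (forall t, t != s -> f t = 0) -> forall t, f t = 0.
Proof.
move=> fp f0; apply: (@polyfun_eq0 _ (fun t => t - s) (s + 1)) => //.
- exact: polyfunD polyfun_id (polyfun_cst _).
- by rewrite addrC addKr oner_neq0.
- by move=> t; rewrite subr_eq0; apply: f0.
Qed.

Lemma coef_eq0_punctured D (b : nat -> K) s :
  (forall t, t != s -> \sum_(e < D) t ^+ e * b e = 0) ->
  forall e, (e < D)%N -> b e = 0.
Proof.
move=> b0 e ltD; pose p := \poly_(e < D) b e.
suff p0 : p = 0 by have := coef_poly D b e; rewrite -/p p0 coef0 ltD.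
apply: poly_eq0_horner => t; apply: (@polyfun_punctured (horner p) s); first by exists p.
move=> u /b0 <-; rewrite horner_poly; apply: eq_bigr => i _; exact: mulrC.
Qed.

End PolynomialFunctions.

(** The value at x of the polynomial in N variables, of degree below D in each, whose coefficients
    are given by [a]. Recursion on the last variable makes its coefficients with respect to that
    variable objects of the same kind. *)
Fixpoint eval_coefs (K : nzRingType) (D N : nat) (a : seq nat -> K) (x : nat -> K) : K :=
  if N is N'.+1
  then \sum_(e < D) x N' ^+ e * eval_coefs D N' (fun s => a (nat_of_ord e :: s)) x
  else a [::].

(** * Standard polynomials vanishing on sums of points of the curve *)

Section Independence.
Variables (K : closedFieldType) (D : nat).
Implicit Types (a : seq nat -> K) (x : nat -> K).

Notation good N s := ((size s == N) && all (fun e => e < D)%N s).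

Lemma eq_eval_coefs N a x y : (forall j, (j < N)%N -> x j = y j) ->
  eval_coefs D N a x = eval_coefs D N a y.
Proof.
elim: N a => [//|N IH] a exy /=; apply: eq_bigr => e _.
by rewrite exy // (IH _) // => j jN; apply: exy; apply: ltnW.
Qed.

Lemma eval_coefs_eq0 N a x :
  (forall s, good N s -> a s = 0) -> eval_coefs D N a x = 0.
Proof.
elim: N a => [|N IH] a a0 /=; first exact: a0.
by rewrite big1 // => e _; rewrite IH ?mulr0 // => s gs; apply: a0; rewrite /= ltn_ord.
Qed.

Lemma polyfun_eval_coefs N a (x : K -> nat -> K) :
  (forall j, (j < N)%N -> polynomial_function (x^~ j)) ->
  polynomial_function (fun t => eval_coefs D N a (x t)).
Proof.
elim: N a => [|N IH] a xp /=; first exact: polyfun_cst.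
apply: polyfun_sum => e; apply: polyfunM; first by apply/polyfunX/xp.
by apply: IH => j jN; apply: xp; apply: ltnW.
Qed.

(** A sum of k points of the affine cone over the curve, in the chart where a point of the line is
    (1 : t). *)
Definition moment k (c t : nat -> K) : nat -> K :=
  fun j => \sum_(i < k) c i * t i ^+ j.

Definition vanishes_on_moments k N a : Prop :=
  forall c t : nat -> K, eval_coefs D N a (moment k c t) = 0.

(* [e] is the degree in the last variable. Adding to a point [y] the point
   [nu * eps ^ M.-1 * (1, eps^-1, eps^-2, ...)] and letting [eps] tend to 0, the
   leading coefficient vanishes on the cone over the secant variety of one
   point less with vertex a coordinate point. *)
Lemma leading_coef_vanishes k M a e (c t : nat -> K) nu :
  vanishes_on_moments k.+1 M.+2 a -> nu != 0 -> (e < D)%N ->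
  (forall e' s, (e < e' < D)%N -> good M.+1 s -> a (e' :: s) = 0) ->
  eval_coefs D M.+1 (fun s => a (e :: s))
    (fun j => moment k c t j + (if j == M then nu else 0)) = 0.
Proof.
move=> van nu0 ltD a0; set y := moment k c t.
pose z eps j := y j + nu * eps ^+ (M - j).
(* For [eps != 0] this is [eps ^+ e] times the value at the perturbed point: the last coordinate
   there is [y M.+1 + nu / eps], and degrees above [e] do not contribute. Written this way it has no
   pole at 0. *)
pose f eps := \sum_(e' < e.+1) eps ^+ (e - e') * (eps * y M.+1 + nu) ^+ e' *
  eval_coefs D M.+1 (fun s => a (nat_of_ord e' :: s)) (z eps).
have fp : polynomial_function f.
  apply: polyfun_sum => e'; apply: polyfunM.
    apply: polyfunM; first exact/polyfunX/polyfun_id.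
    apply/polyfunX/polyfunD; last exact: polyfun_cst.
    by apply: polyfunM; [exact: polyfun_id|exact: polyfun_cst].
  apply: polyfun_eval_coefs => j _; apply: polyfunD; first exact: polyfun_cst.
  by apply: polyfunM; [exact: polyfun_cst|exact/polyfunX/polyfun_id].
have f0 eps : eps != 0 -> f eps = 0.
  move=> eps0.
  pose c' i := if i == k then nu * eps ^+ M else c i.
  pose t' i := if i == k then eps^-1 else t i.
  have zE j : moment k.+1 c' t' j = y j + nu * eps ^+ M * eps^-1 ^+ j.
    rewrite /moment big_ord_recr /= /c' /t' eqxx; congr (_ + _).
    by apply: eq_bigr => i _; rewrite (ltn_eqF (ltn_ord i)).
  have zlt j : (j < M.+1)%N -> moment k.+1 c' t' j = z eps j.
    rewrite ltnS => jM; rewrite zE /z -(subnKC jM) addKn exprD mulrA mulrAC.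
    by rewrite -(mulrA nu) -exprMn mulfV // expr1n mulr1 mulrC.
  have zM : eps * moment k.+1 c' t' M.+1 = eps * y M.+1 + nu.
    rewrite zE mulrDr; congr (_ + _).
    by rewrite -mulrA mulrCA (mulrA eps) -exprS -exprMn mulfV // expr1n mulr1.
  have := van c' t'; rewrite /= => /(congr1 (fun r => eps ^+ e * r)).
  rewrite mulr0 => <-; rewrite [RHS]mulr_sumr /f.
  pose F (e' : nat) := eps ^+ (e - e') * (eps * y M.+1 + nu) ^+ e' *
    eval_coefs D M.+1 (fun s => a (e' :: s)) (z eps).
  rewrite -[LHS]/(\sum_(e' < e.+1) F e') (big_ord_widen D F) // big_mkcond.
  apply: eq_bigr => e' _; rewrite ltnS; case: leqP => he.
    rewrite /F -zM exprMn !mulrA -exprD subnK //; congr (_ * _).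
    by apply: eq_eval_coefs => j jM; rewrite zlt.
  by have /= -> := @eval_coefs_eq0 M.+1 (fun s => a (nat_of_ord e' :: s)) (moment k.+1 c' t')
    (fun s => a0 e' s (introT andP (conj he (ltn_ord e')))); rewrite !mulr0.
(* At [eps = 0] only the summand of degree [e] survives, with the nonzero factor [nu ^+ e], and
   [z 0] adds [nu] to coordinate [M] alone. *)
have := polyfun_punctured fp f0 0.
rewrite /f big_ord_recr big1 /= => [|i _]; last first.
  by rewrite expr0n subn_eq0 leqNgt ltn_ord mul0r mul0r.
rewrite add0r subnn expr0 mul1r mul0r add0r => /eqP.
rewrite mulf_eq0 expf_eq0 (negbTE nu0) andbF /= => /eqP ev0.
rewrite -[RHS]ev0 -/(eval_coefs D M.+1 (fun s => a (e :: s)) _).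
apply: eq_eval_coefs => j; rewrite /z expr0n subn_eq0 ltnS => jM.
by rewrite [(M <= j)%N]leq_eqVlt ltnNge jM orbF eq_sym; case: eqP; rewrite ?mulr1 ?mulr0.
Qed.

Lemma vanishing_standard_coefs_eq0 k N a :
  (forall s, (k < chain_number s)%N -> a s = 0) ->
  vanishes_on_moments k N a -> forall s, good N s -> a s = 0.
Proof.
elim/ltn_ind: N k a => -[|N] IH k a std van s gs.
  by move: gs (van (fun _ => 0) (fun _ => 0)); case: s.
(* Once the coefficients of positive degree in the last variable vanish, the polynomial does not
   involve that variable, and induction on N applies with the same k. *)
have low e s' : (0 < e < D)%N -> good N s' -> a (e :: s') = 0; last first.
  case: s gs => [//|[|e] s] /=; last first.
    by rewrite eqSS => /and3P[sN eD sD]; apply: low; rewrite ?sN.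
  rewrite eqSS => /and3P[sN eD sD].
  apply: (IH N (ltnSn N) k (fun s => a (0%N :: s))) => [s' lts||]; last by rewrite sN.
    exact: std.
  move=> c t; have := van c t; rewrite /=.
  rewrite (bigD1 (Ordinal eD)) //= expr0 mul1r big1 ?addr0 // => e eN0.
  rewrite eval_coefs_eq0 ?mulr0 // => s' gs'; apply: low => //.
  by rewrite ltn_ord andbT lt0n.
case: k => [|k] in std van *.
  by case: e => // e _ _; apply: std; case: s'.
(* With a single variable, the one-point sums already take every value u. *)
case: N => [|M] in IH van s gs s' *.
  case: s' => // /andP[_ eD] _; apply: (@coef_eq0_punctured K D (fun e => a [:: e]) 0) => // u _.
  rewrite -[RHS](van (fun i => if i == 0%N then u else 0) (fun => 0)) /=.
  apply: eq_bigr => i _; congr (_ ^+ _ * _).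
  by rewrite /moment big_ord_recl big1 ?expr0 ?mulr1 ?addr0 // => j _; rewrite mul0r.
(* Downward induction on [e], so that [e] is the leading degree when [leading_coef_vanishes] is
   applied. The coefficients [e :: f :: s] are then standard in [s] for one point less, since a
   positive [e] adds one to the chain number and skips [f]. *)
have [m] := ubnP (D - e); elim: m e s' => // m IHm e s' ltm /andP[e0 eD].
case: s' => [//|f s']; rewrite /= eqSS => /and3P[sM fD sD].
apply: (IH M _ k (fun s => a (e :: f :: s))) => //; last by rewrite sM.
  by move=> s'' lts; apply: std; case: e e0 {ltm eD}.
(* Choosing [nu = u - moment k c t M] gives coordinate [M] the value u, free except for one excluded
   value; hence each coefficient in that variable vanishes on the sums of k points. *)
move=> c t; apply: (@coef_eq0_punctured K D
  (fun f => eval_coefs D M (fun s => a (e :: f :: s)) (moment k c t)) (moment k c t M)) => // u uy.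
have nu0 : u - moment k c t M != 0 by rewrite subr_eq0.
rewrite -[RHS](leading_coef_vanishes c t van nu0 eD) => [|e' s'' /andP[lte ltD] gs'']; last first.
  by apply: IHm => //; [lia | rewrite (leq_trans _ lte) ?ltD].
rewrite /=; apply: eq_bigr => i _; rewrite eqxx addrCA subrr addr0; congr (_ * _).
by apply: eq_eval_coefs => j jM; rewrite (ltn_eqF jM) addr0.
Qed.

End Independence.

(** * Hankel minors *)

Lemma chain_indices k s : (k < chain_number s)%N ->
  exists i : nat -> nat, (forall c, c < k -> i c + 2 <= i c.+1)%N /\
    (forall c, c <= k -> 0 < nth 0 (rev s) (i c))%N.
Proof.
have [m] := ubnP (size s); elim: m k s => // m IH k [|[|e] s] //= ltm ltk.
  have [i [gap pos]] := IH k s ltm ltk; exists i; split=> // c ck.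
  move: (pos c ck); rewrite rev_cons nth_rcons; case: (ltnP (i c) (size _)) => // lei.
  by rewrite nth_default.
have last_pos : (0 < nth 0 (rev (e.+1 :: s)) (size s))%N.
  by rewrite rev_cons nth_rcons size_rev ltnn eqxx.
case: k => [|k] in ltk *; first by exists (fun=> size s).
case: s => [|f s] // in ltk ltm last_pos *.
have [i [gap pos]] := IH k s (ltnW ltm) ltk.
have lti c : (c <= k)%N -> (i c < size s)%N.
  move=> /pos; apply: contraTT; rewrite -!leqNgt leqn0 => ?.
  by rewrite nth_default ?size_rev.
(* The added index is that of the last variable; the skipped variable [f] ensures the gap of 2. *)
exists (fun c => if (c <= k)%N then i c else (size s).+1); split=> c ck.
  rewrite (ck : (c <= k)%N); case: ltnP => [|_]; first exact: gap.
  by rewrite addn2 ltnS lti.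
case: ifP => [ck'|_]; last exact: last_pos.
by rewrite !rev_cons !nth_rcons !size_rcons size_rev (ltn_trans (lti c ck')) // lti // pos.
Qed.

(* At the largest index moved by [s] the exponent drops, which the at most k + 1
   terms up to that index cannot make up for, the base being k + 2. *)
Lemma perm_power_sum_lt k (b : nat -> nat) (s : 'S_k.+1) :
  (forall c, c < k -> b c < b c.+1)%N -> s != 1%g ->
  (\sum_(c < k.+1) k.+2 ^ (b c + s c) < \sum_(c < k.+1) k.+2 ^ (b c + c))%N.
Proof.
move=> binc s1.
have blt c c' : (c < c' <= k)%N -> (b c < b c')%N.
  move=> /andP[]; elim: c' => // c' IH; rewrite ltnS leq_eqVlt => /orP[/eqP->|lt] ltk.
    exact: binc.
  by apply: ltn_trans (binc _ ltk); apply: IH => //; apply: ltnW.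
have [c0 sc0] : exists c, s c != c.
  apply/existsP; apply: contraR s1 => /existsPn s_id.
  by apply/eqP/permP => c; rewrite perm1; apply/eqP/negbNE/s_id.
case: (@arg_maxnP _ c0 (fun c => s c != c) (fun c => c)) => //= {c0 sc0} c0 sc0 max0.
have fixs (c : 'I_k.+1) : (c0 < c)%N -> s c = c.
  by move=> ltc; apply/eqP/negbNE/negP => /max0; rewrite leqNgt ltc.
have les (c : 'I_k.+1) : (c <= c0)%N -> (s c <= c0)%N.
  move=> lec; rewrite leqNgt; apply/negP => lt0.
  by have /perm_inj sc := fixs _ lt0; rewrite sc ltnNge lec in lt0.
have lts0 : (s c0 < c0)%N by rewrite ltn_neqAle sc0 les.
pose P (c : 'I_k.+1) := (c <= c0)%N.
rewrite (bigID P) [ltnRHS](bigID P) /P /=.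
rewrite [X in (_ + X < _)%N](eq_bigr (fun c : 'I_k.+1 => k.+2 ^ (b c + c))%N) => [|c]; last first.
  by rewrite -ltnNge => /fixs ->.
rewrite ltn_add2r (bigD1 c0) //= [ltnRHS](bigD1 c0) //= .
set i := (b c0 + c0)%N.
have i_gt0 : (0 < i)%N by rewrite /i; lia.
apply: leq_trans (leq_addr _ _).
rewrite -(bigD1 c0 (P := P) (F := fun c => (k.+2 ^ (b c + s c))%N)) /P //=.
apply: (@leq_ltn_trans (\sum_(c < k.+1) k.+2 ^ i.-1)%N).
  (* Each exponent is below [i]: at [c0] because [s] drops there, and at smaller indices because [b]
     is strictly smaller while [s] stays at most [c0]. *)
  rewrite big_mkcond; apply: leq_sum => c _; case: ifP => // lec.
  rewrite leq_exp2l //.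
  have := les _ lec; have := ltn_ord c0.
  have [->|nec] := eqVneq c c0; first by rewrite /i; lia.
  have := @blt c c0; rewrite ltn_neqAle lec nec /i; lia.
rewrite sum_nat_const card_ord -[in ltnRHS](prednK i_gt0) expnS ltn_mul2r expn_gt0 /=; lia.
Qed.

Lemma det_mul_small (K : fieldType) p q (A : 'M[K]_(p, q)) (B : 'M[K]_(q, p)) :
  (q < p)%N -> \det (A *m B) = 0.
Proof.
move=> ltqp; apply/eqP; apply: contraTT ltqp => det0.
have : (A *m B) \in unitmx by rewrite unitmxE unitfE.
rewrite -row_free_unit /row_free => /eqP rk.
by rewrite -leqNgt -{1}rk (leq_trans (mxrankM_maxl _ _)) // rank_leq_col.
Qed.

Definition secant_point (K : closedFieldType) n k (c : 'I_k -> K) (u : 'I_k -> 'rV[K]_2) :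
  'rV[K]_n.+1 := \sum_i c i *: veronese n (u i).

(** The Hankel matrix of one point of the cone over the curve has rank at most 1, so that of a sum
    of k points factors through dimension k. The bound on [b] keeps all indices in range and the
    exponents untruncated. *)
Lemma hankel_minor_eq0 (K : closedFieldType) n k (b : nat -> nat) (c : 'I_k -> K)
    (u : 'I_k -> 'rV[K]_2) :
  (forall i, i <= k -> b i + k <= n)%N ->
  \det (\matrix_(i < k.+1, j < k.+1) secant_point n c u 0 (inord (b i + j))) = 0.
Proof.
move=> ble.
pose A := \matrix_(i < k.+1, l < k) (c l * u l 0 0 ^+ (n - k - b i) * u l 0 1 ^+ b i).
pose B := \matrix_(l < k, j < k.+1) (u l 0 0 ^+ (k - j) * u l 0 1 ^+ j).
rewrite (_ : \matrix_(_, _) _ = A *m B) ?det_mul_small //.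
apply/matrixP => i j; rewrite !mxE summxE; apply: eq_bigr => l _.
have := ble i (leq_ord i); have := leq_ord j => lej leb.
rewrite !mxE inordK; last by lia.
rewrite (_ : n - (b i + j) = (n - k - b i) + (k - j))%N; last by lia.
by rewrite !exprD; ring.
Qed.

(** * Straightening *)

Definition standard n k (m : 'X_{1..n}) : bool := (chain_number (rev m) <= k)%N.

(** The numerical stand-in for a term order; straightening takes B = k + 2, which makes the diagonal
    term of a Hankel minor the heaviest. *)
Definition mnm_weight n B (m : 'X_{1..n}) : nat := (\sum_(j < n) m j * B ^ j)%N.

Lemma mnm_weightD n B (m1 m2 : 'X_{1..n}) :
  mnm_weight B (m1 + m2) = (mnm_weight B m1 + mnm_weight B m2)%N.
Proof. by rewrite -big_split; apply: eq_bigr => j _; rewrite mnmDE mulnDl. Qed.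

Lemma mnm_weightU n B (i : 'I_n) : mnm_weight B U_(i) = (B ^ i)%N.
Proof.
rewrite /mnm_weight (bigD1 i) //= mnm1E eqxx mul1n big1 ?addn0 // => j ji.
by rewrite mnm1E eq_sym (negbTE ji).
Qed.

Lemma mnm_weight_sum n B (I : Type) (r : seq I) (f : I -> 'X_{1..n}) :
  mnm_weight B (\sum_(i <- r) f i) = (\sum_(i <- r) mnm_weight B (f i))%N.
Proof.
elim: r => [|i r IH]; last by rewrite !big_cons mnm_weightD IH.
by rewrite !big_nil /mnm_weight big1 // => j _; rewrite mnm0E.
Qed.

(** A chain i_0, ..., i_k with gaps at least 2 is written i_c = b_c + c. Then b is strictly
    increasing, and the chain is the diagonal of the Hankel minor with rows b and columns 0, ...,
    k. *)
Lemma nonstandard_factor n k (m : 'X_{1..n.+1}) : ~~ standard k m ->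
  exists (b : nat -> nat) (m' : 'X_{1..n.+1}),
    [/\ forall c, (c < k -> b c < b c.+1)%N,
        forall c, (c <= k -> b c + k <= n)%N &
        m = (m' + \sum_(c < k.+1) U_(inord (b c + c)))%MM].
Proof.
rewrite /standard -ltnNge => /chain_indices[i [gap]].
rewrite revK => pos.
have ilt c : (c <= k)%N -> (i c < n.+1)%N.
  move=> /pos; apply: contraTT; rewrite -!leqNgt leqn0 => ?.
  by rewrite nth_default ?size_tuple.
have igap c c' : (c <= c' <= k)%N -> (i c + (c' - c).*2 <= i c')%N.
  elim: c' => [|c' IH]; first by rewrite leqn0 => /andP[/eqP-> _]; rewrite addn0.
  case/andP; rewrite leq_eqVlt => /orP[/eqP<-|]; first by rewrite subnn addn0.
  by rewrite ltnS => lec ltk; have := gap _ ltk; have := IH; lia.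
exists (fun c => i c - c)%N.
have ige c : (c <= k -> c <= i c)%N by move=> ck; have := igap 0%N c ck; lia.
have bK (c : 'I_k.+1) : (i c - c + c = i c)%N by rewrite subnK // ige // leq_ord.
exists (m - \sum_(c < k.+1) U_(inord (i c - c + c)))%MM; split.
- by move=> c ck; have := gap c ck; have := ige c (ltnW ck); have := ige _ ck; lia.
- move=> c ck; have := igap c k; rewrite ck leqnn => /(_ isT).
  by have := ilt k (leqnn _); have := ige c ck; lia.
rewrite submK //; apply/mnm_lepP => j; rewrite mnm_sumE.
have [/existsP[c /eqP <-]|/existsPn noc] :=
  boolP [exists c : 'I_k.+1, inord (i c) == j]; last first.
  by rewrite big1 // => c _; rewrite bK mnm1E (negbTE (noc c)).
rewrite (bigD1 c) //= bK mnm1E eqxx big1 ?addn0 => [|c' neq].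
  by rewrite (mnm_nth 0) inordK ?ilt ?pos // leq_ord.
rewrite bK mnm1E; case: eqP => // /(congr1 val); rewrite /= !inordK ?ilt ?leq_ord // => ii.
case/eqP: neq; apply/val_inj => /=.
have := igap c c'; have := igap c' c; have := leq_ord c; have := leq_ord c'.
by case: (ltngtP c c') => //; lia.
Qed.

Section Spanning.
Variables (K : closedFieldType) (n k d : nat).

(** The default value 0 is taken when the degree of [m] is not [d]. *)
Definition monomial (m : 'X_{1..n.+1}) : dhomog n.+1 K d := insubd 0 'X_[m].

Lemma val_monomial m : mdeg m = d -> val (monomial m) = 'X_[m].
Proof.
move=> md; rewrite val_insubd.
have /= -> : 'X_[m] \is [in K[n.+1], d.-homog] by rewrite dhomogX; apply/eqP.
by [].
Qed.

Lemma dhomog_mdeg (F : dhomog n.+1 K d) m : m \in msupp (val F) -> mdeg m = d.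
Proof. by move=> mF; have := dhomog_mf (valP F) mF. Qed.

Lemma dhomog_sum_monomial (F : dhomog n.+1 K d) :
  F = \sum_(m <- msupp (val F)) (val F)@_m *: monomial m.
Proof.
apply: val_inj; rewrite raddf_sum [LHS]mpolyE big_seq [RHS]big_seq /=.
apply: eq_bigr => m mF; rewrite -[in RHS]mul_mpolyC /= mul_mpolyC.
by rewrite val_monomial // (dhomog_mdeg mF).
Qed.

Variables (I W : {vspace dhomog n.+1 K d}).
Hypothesis sub_I : forall F : dhomog n.+1 K d,
  (forall c (u : 'I_k -> 'rV_2), (val F).@[secant_point n c u 0] = 0) -> F \in I.
Hypothesis standard_W : forall m, mdeg m = d -> standard k m -> monomial m \in W.

(** Induction on the weight. A nonstandard m is the diagonal term of a monomial times a Hankel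
    minor; this product lies in I, and its other terms have smaller weight. *)
Lemma monomial_in_span m : mdeg m = d -> monomial m \in (W + I)%VS.
Proof.
have [w] := ubnP (mnm_weight k.+2 m); elim: w m => // w IH m; rewrite ltnS => lew md.
have [st|] := boolP (standard k m).
  by apply: (subvP (addvSl W I)); apply: standard_W.
move=> /nonstandard_factor[b [m' [binc ble mE]]].
pose ms (s : 'S_k.+1) := (m' + \sum_(c < k.+1) U_(inord (b c + s c)))%MM.
have ms1 : ms 1%g = m.
  by rewrite mE; congr (_ + _)%MM; apply: eq_bigr => c _; rewrite perm1.
have mdegs s : mdeg (ms s) = d.
  rewrite -md mE /ms !mdegD !mdeg_sum; congr (_ + _)%N.
  by apply: eq_bigr => c _; rewrite !mdeg1.
have weights s : s != 1%g -> (mnm_weight k.+2 (ms s) < w)%N.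
  move=> s1; apply: leq_trans lew; rewrite mE /ms !mnm_weightD ltn_add2l !mnm_weight_sum.
  have wE (t : 'I_k.+1 -> 'I_k.+1) :
      (\sum_(c < k.+1) mnm_weight k.+2 U_(inord (b c + t c) : 'I_n.+1) =
      \sum_(c < k.+1) k.+2 ^ (b c + t c))%N.
    apply: eq_bigr => c _; rewrite mnm_weightU inordK //.
    by have := ble c (leq_ord c); have := leq_ord (t c); lia.
  by rewrite (wE s) (wE id) perm_power_sum_lt.
pose D := \sum_(s : 'S_k.+1) (-1) ^+ s *: monomial (ms s).
have DI : D \in I.
  apply: sub_I => c u; set x := secant_point n c u 0.
  rewrite raddf_sum raddf_sum /=.
  transitivity ('X_[m'].@[x] * \det (\matrix_(i < k.+1, j < k.+1) x (inord (b i + j)))); last first.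
    by rewrite hankel_minor_eq0 ?mulr0.
  rewrite /determinant mulr_sumr; apply: eq_bigr => s _.
  rewrite mevalZ val_monomial // /ms mpolyXD mevalM -mprodXE rmorph_prod /= mulrCA.
  congr (_ * (_ * _)).
  by apply: eq_bigr => i _; rewrite mevalXU mxE.
have -> : monomial m = D - \sum_(s : 'S_k.+1 | s != 1%g) (-1) ^+ s *: monomial (ms s).
  by rewrite /D (bigD1 1%g) //= odd_perm1 expr0 scale1r ms1 addrK.
rewrite memvB //; first by apply: (subvP (addvSr W I)).
by apply: memv_suml => s s1; apply/memvZ/IH => //; apply: weights.
Qed.

Lemma standard_span : (W + I)%VS = fullv.
Proof.
apply/eqP; rewrite eqEsubv subvf /=; apply/subvP => F _.
rewrite (dhomog_sum_monomial F) big_seq; apply: memv_suml => m mF.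
by apply/memvZ/monomial_in_span/(dhomog_mdeg mF).
Qed.

End Spanning.

(** * The codimension of the ideal *)

Lemma eval_coefs_sum (K : comNzRingType) D N (I : Type) (r : seq I) (c : I -> K)
    (b : I -> seq nat -> K) x :
  eval_coefs D N (fun s => \sum_(i <- r) c i * b i s) x =
  \sum_(i <- r) c i * eval_coefs D N (b i) x.
Proof.
elim: N b => [//|N IH] b /=.
under eq_bigr do rewrite IH mulr_sumr.
rewrite exchange_big; apply: eq_bigr => i _; rewrite mulr_sumr.
by apply: eq_bigr => e _; rewrite mulrCA.
Qed.

Lemma eval_coefs_delta (K : comNzRingType) D N s (x : nat -> K) :
  size s = N -> all (fun e => e < D)%N s ->
  eval_coefs D N (fun s' => (s' == s)%:R) x = \prod_(j < N) x j ^+ nth 0 (rev s) j.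
Proof.
elim: N s => [|N IH] [|e s] //=; first by rewrite big_ord0.
move=> [sN] /andP[eD sD]; rewrite (bigD1 (Ordinal eD)) //= big1 ?addr0.
  rewrite big_ord_recr /= rev_cons nth_rcons size_rev sN ltnn eqxx mulrC; congr (_ * _).
  transitivity (eval_coefs D N (fun s' => (s' == s)%:R) x).
    by congr (eval_coefs _ _ _ _); apply/funext => s'; rewrite eqseq_cons eqxx.
  rewrite IH //; apply: eq_bigr => j _.
  by rewrite nth_rcons size_rev sN ltn_ord.
move=> f fe; transitivity (x N ^+ f * eval_coefs D N (fun _ => 0) x).
  congr (_ * eval_coefs _ _ _ _); apply/funext => s'; rewrite eqseq_cons.
  by have /negbTE -> : nat_of_ord f != e by apply: contra fe => /eqP fe; apply/eqP/val_inj.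
suff -> : eval_coefs D N (fun=> 0) x = 0 by rewrite mulr0.
by elim: {IH sN} N => //= N IH; rewrite big1 // => ? _; rewrite IH mulr0.
Qed.

Section HilbertFunction.
Variables (K : closedFieldType) (n k d : nat).
Implicit Types (F : dhomog n.+1 K d) (m : 'X_{1..n.+1}).

Lemma size_rev_mnm m : size (rev m) = n.+1.
Proof. by rewrite size_rev size_tuple. Qed.

Lemma rev_mnm_inj : injective (fun m => rev m).
Proof. by move=> m1 m2 /(can_inj revK) e; apply/val_inj/val_inj. Qed.

Lemma all_rev_mnm m : mdeg m = d -> all (fun e => e < d.+1)%N (rev m).
Proof.
move=> md; rewrite all_rev; apply/(all_nthP 0) => i; rewrite size_tuple => lti.
rewrite ltnS -md -(mnm_nth 0 m (Ordinal lti)) mdegE (bigD1 (Ordinal lti)) //=.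
exact: leq_addr.
Qed.

(** The coefficient function in the form expected by [eval_coefs], last variable first. Being a
    combination of indicator functions, it can be evaluated by linearity. *)
Definition coefs F (s : seq nat) : K :=
  \sum_(m <- msupp (val F)) (val F)@_m * (s == rev m)%:R.

Lemma coefs_rev F m : coefs F (rev m) = (val F)@_m.
Proof.
rewrite /coefs; have [mF|mF] := boolP (m \in msupp (val F)).
  rewrite (bigD1_seq m) ?msupp_uniq //= eqxx mulr1 big1 ?addr0 // => m' mm'.
  by rewrite (inj_eq rev_mnm_inj) eq_sym (negbTE mm') mulr0.
rewrite big_seq big1 ?memN_msupp_eq0 // => m' m'F.
rewrite (inj_eq rev_mnm_inj); case: eqP => [mm'|]; last by rewrite mulr0.
by rewrite mm' m'F in mF.
Qed.

Lemma meval_coefs F (x : nat -> K) :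
  (val F).@[fun i : 'I_n.+1 => x i] = eval_coefs d.+1 n.+1 (coefs F) x.
Proof.
rewrite eval_coefs_sum mevalE big_seq [RHS]big_seq; apply: eq_bigr => m mF.
rewrite eval_coefs_delta ?size_rev_mnm ?all_rev_mnm ?(dhomog_mdeg mF) // revK.
by congr (_ * _); apply: eq_bigr => i _; rewrite (mnm_nth 0).
Qed.

Lemma standard_form_eq0 F :
  (forall m, m \in msupp (val F) -> standard k m) ->
  (forall c (u : 'I_k -> 'rV_2), (forall i, u i != 0) ->
    (val F).@[secant_point n c u 0] = 0) ->
  F = 0.
Proof.
move=> std van; apply/val_inj/mpolyP => m; rewrite mcoeff0 -coefs_rev.
have [md|md] := eqVneq (mdeg m) d; last first.
  rewrite coefs_rev; apply: memN_msupp_eq0.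
  by apply: contra md => /dhomog_mdeg ->.
apply: (@vanishing_standard_coefs_eq0 K d.+1 k n.+1 (coefs F)).
- move=> s lts; rewrite /coefs big_seq big1 // => m' /std.
  rewrite /standard; case: eqP => [<-|]; last by rewrite mulr0.
  by rewrite leqNgt lts.
- move=> c t; rewrite -meval_coefs.
  (* The vectors (1, t_i) are nonzero, and the coordinates of their secant point are the moments. *)
  pose u (i : 'I_k) : 'rV[K]_2 := \row_j (if j == 0 then 1 else t i).
  rewrite -[RHS](van (fun i => c i) u) => [|i]; last first.
    by apply/eqP => /rowP /(_ 0); rewrite !mxE eqxx; apply/eqP/oner_neq0.
  apply: meval_eq => j; rewrite /moment /secant_point summxE.
  by apply: eq_bigr => i _; rewrite !mxE /= expr1n mul1r.
- by rewrite size_rev_mnm eqxx all_rev_mnm.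
Qed.

Lemma span_monomial_coef (M : seq 'X_{1..n.+1}) F m :
  F \in <<map (monomial K d) M>>%VS -> (forall m, m \in M -> mdeg m = d) ->
  m \notin M -> (val F)@_m = 0.
Proof.
move=> FM degM mM; rewrite (coord_span (X := in_tuple _) FM) raddf_sum raddf_sum /=.
apply: big1 => i _; rewrite mcoeffZ.
have ltM : (i < size M)%N by have := ltn_ord i; rewrite [X in (_ < X)%N]size_map.
rewrite (nth_map 0%MM) // val_monomial ?degM ?mem_nth // mcoeffX.
by case: eqP => [e|]; [rewrite -e mem_nth in mM | rewrite mulr0].
Qed.

Lemma free_monomials (M : seq 'X_{1..n.+1}) : uniq M ->
  (forall m, m \in M -> mdeg m = d) -> free (map (monomial K d) M).
Proof.
elim: M => [|m M IH] /=; first by rewrite nil_free.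
move=> /andP[mM uM] degM; rewrite free_cons IH // => [|m' m'M]; last first.
  by apply: degM; rewrite inE m'M orbT.
rewrite andbT; apply/negP => /span_monomial_coef -/(_ m) H.
have : (val (monomial K d m))@_m = 0.
  apply: H => // m' m'M; by apply: degM; rewrite inE m'M orbT.
rewrite val_monomial ?degM ?mem_head // mcoeffX eqxx => /eqP.
by rewrite oner_eq0.
Qed.

Definition standard_monomials : seq 'X_{1..n.+1} :=
  [seq [multinom nth 0%N (rev s) i | i < n.+1]%MM |
    s <- [seq s <- exponents n.+1 d | chain_number s <= k]%N].

Lemma rev_multinom s : size s = n.+1 ->
  rev [multinom nth 0%N (rev s) i | i < n.+1] = s.
Proof.
move=> sz; rewrite -[RHS]revK; congr rev; apply: (@eq_from_nth _ 0%N).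
  by rewrite size_tuple size_rev.
move=> i; rewrite size_tuple => lti.
by rewrite -(mnm_nth 0 _ (Ordinal lti)) mnmE.
Qed.

Lemma mem_standard_monomials m :
  (m \in standard_monomials) = (mdeg m == d) && standard k m.
Proof.
apply/mapP/andP => [[s]|[/eqP md st]].
  rewrite mem_filter mem_exponents => /and3P[chs /eqP sz /eqP sd] ->.
  rewrite /standard rev_multinom //; split=> //.
  by rewrite -sd -[in sumn s](rev_multinom sz) sumn_rev sumnE.
exists (rev m); last first.
  by apply/rev_mnm_inj; rewrite rev_multinom // size_rev_mnm.
rewrite mem_filter mem_exponents size_rev_mnm eqxx sumn_rev.
by rewrite -md sumnE eqxx !andbT.
Qed.

Lemma size_standard_monomials : size standard_monomials = standard_count n.+1 k d.
Proof. by rewrite size_map size_filter. Qed.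

Lemma standard_monomials_uniq : uniq standard_monomials.
Proof.
rewrite map_inj_in_uniq ?filter_uniq ?exponents_uniq // => s t.
rewrite !mem_filter !mem_exponents => /and3P[_ /eqP ss _] /and3P[_ /eqP st _] e.
by rewrite -(rev_multinom ss) e rev_multinom.
Qed.

(** The standard monomials span a complement of I: straightening gives [W + I = fullv], and
    independence gives a zero intersection. *)
Lemma codim_secant_ideal (I : {vspace dhomog n.+1 K d}) :
  (forall F, F \in I <-> forall c (u : 'I_k -> 'rV_2), (forall i, u i != 0) ->
    (val F).@[secant_point n c u 0] = 0) ->
  (\dim {: dhomog n.+1 K d} - \dim I = standard_count n.+1 k d)%N.
Proof.
move=> IP; pose W := <<map (monomial K d) standard_monomials>>%VS.
have degM m : m \in standard_monomials -> mdeg m = d.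
  by rewrite mem_standard_monomials => /andP[/eqP].
have WI : (W + I)%VS = fullv.
  apply: (@standard_span K n k d) => [F van|m md st]; first by apply/IP.
  by apply: memv_span; apply/map_f; rewrite mem_standard_monomials md eqxx.
have capWI : (W :&: I)%VS = 0%VS.
  apply/eqP; rewrite -subv0; apply/subvP => F /memv_capP[FW /IP van].
  rewrite memv0; apply/eqP; apply: standard_form_eq0 => // m.
  apply: contraTT => nst; rewrite -mcoeff_eq0; apply/eqP/(span_monomial_coef FW) => //.
  by rewrite mem_standard_monomials (negbTE nst) andbF.
have := dimv_disjoint_sum capWI; rewrite WI => ->; rewrite addnK.
have /eqP -> : free (map (monomial K d) standard_monomials).
  exact: free_monomials standard_monomials_uniq degM.
by rewrite size_map size_standard_monomials.
Qed.

End HilbertFunction.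

(** * Coordinate changes and secant varieties *)

Local Open Scope classical_set_scope.

(** * Linear substitutions in forms *)

Section LinearSubstitution.
Variables (K : closedFieldType) (n d : nat).
Implicit Types (g h : 'M[K]_n.+1) (F : dhomog n.+1 K d).

Definition linear_forms g : n.+1.-tuple {mpoly K[n.+1]} :=
  [tuple \sum_l g l j *: 'X_l | j < n.+1].

Lemma tnth_linear_forms g j : tnth (linear_forms g) j = \sum_l g l j *: 'X_l.
Proof. by rewrite tnth_mktuple. Qed.

Lemma meval_comp_linear_forms g (p : {mpoly K[n.+1]}) (v : 'rV[K]_n.+1) :
  (p \mPo linear_forms g).@[v 0] = p.@[(v *m g) 0].
Proof.
rewrite comp_mpoly_meval; apply: meval_eq => j.
rewrite tnth_linear_forms raddf_sum mxE; apply: eq_bigr => l _ /=.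
by rewrite mevalZ mevalXU mulrC.
Qed.

Lemma comp_linear_formsM g h (p : {mpoly K[n.+1]}) :
  (p \mPo linear_forms g) \mPo linear_forms h = p \mPo linear_forms (h *m g).
Proof.
rewrite [p \mPo linear_forms g]comp_mpolyE [RHS]comp_mpolyE raddf_sum /=.
apply: eq_bigr => m _; rewrite comp_mpolyZ rmorph_prod; congr (_ *: _).
apply: eq_bigr => j _; rewrite rmorphXn; congr (_ ^+ _) => /=.
rewrite !tnth_linear_forms raddf_sum /=.
under eq_bigr => l _.
  rewrite comp_mpolyZ comp_mpolyXU -tnth_nth tnth_linear_forms scaler_sumr.
  over.
rewrite exchange_big; apply: eq_bigr => i _; rewrite mxE scaler_suml.
by apply: eq_bigr => l _; rewrite scalerA mulrC.
Qed.

Lemma comp_linear_forms1 (p : {mpoly K[n.+1]}) : p \mPo linear_forms 1%:M = p.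
Proof.
rewrite -[RHS]comp_mpoly_id; congr (_ \mPo _); apply: eq_from_tnth => j.
rewrite tnth_linear_forms tnth_mktuple (bigD1 j) //= mxE eqxx scale1r big1 ?addr0 // => l lj.
by rewrite mxE (negbTE lj) scale0r.
Qed.

Lemma comp_linear_forms_homog g (p : {mpoly K[n.+1]}) :
  p \is d.-homog -> p \mPo linear_forms g \is d.-homog.
Proof.
move=> hp; rewrite comp_mpolyE big_seq; apply: rpred_sum => m mp; apply: rpredZ.
have := dhomog_mf hp mp; rewrite /= mdegE => <-.
have prodH (r : seq 'I_n.+1) : \prod_(i <- r) tnth (linear_forms g) i ^+ m i
    \is (\sum_(i <- r) m i)%N.-homog.
  elim: r => [|i r IH]; first by rewrite !big_nil dhomog1.
  rewrite !big_cons; apply: dhomogM IH.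
  rewrite -[X in X.-homog]mul1n; apply: dhomogMn; rewrite tnth_linear_forms.
  by apply: rpred_sum => l _; apply: rpredZ; rewrite dhomogX /= mdeg1.
exact: prodH.
Qed.

Definition substitution g F : dhomog n.+1 K d :=
  DHomog (comp_linear_forms_homog g (valP F)).

Lemma substitution_linear g : linear (substitution g).
Proof. by move=> c F G; apply: val_inj; rewrite /= comp_mpolyD comp_mpolyZ. Qed.

HB.instance Definition _ g :=
  GRing.isLinear.Build K (dhomog n.+1 K d) (dhomog n.+1 K d) _ (substitution g)
    (substitution_linear g).

Lemma substitutionK g : g \in unitmx -> cancel (substitution g) (substitution (invmx g)).
Proof.
by move=> gu F; apply: val_inj; rewrite /= comp_linear_formsM mulVmx // comp_linear_forms1.
Qed.

End LinearSubstitution.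

(** * Forms vanishing on the secant variety of a projectively transformed Veronese curve *)

Section Geometry.
Variables (K : closedFieldType) (n k : nat) (g : 'M[K]_n.+1).
Hypotheses (g_unit : g \in unitmx) (k_gt0 : (0 < k)%N).
Implicit Types (u : 'rV[K]_2).

Lemma veronese_neq0 u : u != 0 -> veronese n u != 0.
Proof.
apply: contraNN => /eqP/rowP v0; apply/eqP/rowP => j; rewrite !mxE.
have := v0 0; have := v0 ord_max; rewrite !mxE /= subnn subn0 !expr0 mul1r mulr1.
move=> /eqP; rewrite expf_eq0 => /andP[_ /eqP u1] /eqP; rewrite expf_eq0 => /andP[_ /eqP u0].
by case: j => -[|[|//]] lej; [rewrite -[RHS]u0|rewrite -[RHS]u1]; congr (u _ _); apply: val_inj.
Qed.

Definition span_point (v : 'rV[K]_n.+1) (v0 : v != 0) : proj_space K n :=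
  exist _ <[v]>%VS (introT eqP (etrans (dim_vline v) (congr1 nat_of_bool v0))).

Lemma image_line u :
  (linfun (mulmxr g) @: <[veronese n u]>)%VS = <[veronese n u *m g]>%VS.
Proof. by rewrite limg_line lfunE. Qed.

Lemma image_point_neq0 u : u != 0 -> veronese n u *m g != 0.
Proof.
move=> /veronese_neq0; apply: contraNN => /eqP vg0.
by rewrite -[veronese n u](mulmxK g_unit) vg0 mul0mx.
Qed.

Definition image_curve : set (proj_space K n) :=
  [set x | exists2 y, veronese_curve y & val x = (linfun (mulmxr g) @: val y)%VS].

Lemma image_curveP x :
  image_curve x <-> exists2 u, u != 0 & val x = <[veronese n u *m g]>%VS.
Proof.
split=> [[y [u u0 yu] xy]|[u u0 xu]]; first by exists u => //; rewrite xy yu image_line.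
exists (span_point (veronese_neq0 u0)); first by exists u.
by rewrite xu /= image_line.
Qed.
Notation sp c u := (secant_point n c u *m g).

Lemma memv_secant_plane (p : 'I_k -> proj_space K n) (u : 'I_k -> 'rV[K]_2) w :
  (forall i, val (p i) = <[veronese n (u i) *m g]>%VS) ->
  (w \in \sum_(i < k) val (p i))%VS <-> exists c, w = sp c u.
Proof.
move=> pE; split=> [/memv_sumP[ws wsp ->]|[c ->]].
  have wsc i : exists a, ws i = a *: (veronese n (u i) *m g).
    by have := wsp i isT; rewrite pE => /vlineP.
  have [c cE] := choice wsc; exists c; rewrite /secant_point mulmx_suml.
  by apply: eq_bigr => i _; rewrite cE scalemxAl.
rewrite /secant_point mulmx_suml; apply: memv_sumr => i _.
by rewrite -scalemxAl pE memvZ // memv_line.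
Qed.

Lemma polyfun_veronese (x : K -> 'rV[K]_2) (j : 'I_n.+1) :
  (forall l, polynomial_function (fun t => x t 0 l)) ->
  polynomial_function (fun t => (veronese n (x t) *m g) 0 j).
Proof.
move=> xp.
have [p pE] : polynomial_function (fun t =>
   \sum_(l < n.+1) x t 0 0 ^+ (n - l) * x t 0 1 ^+ l * g l j).
  apply: polyfun_sum => l; apply: polyfunM; last exact: polyfun_cst.
  by apply: polyfunM; apply/polyfunX/xp.
by exists p => t; rewrite -pE mxE; apply: eq_bigr => l _; rewrite mxE.
Qed.

(* Along the line through [u0] and [u] the condition on [f] and the
   nonvanishing of all the points only exclude finitely many parameters. *)
Lemma secant_generic (G : {mpoly K[n.+1]}) (f : {mpoly K[k * n.+1]})
    (a : 'I_k -> K) (u0 : 'I_k -> 'rV[K]_2) :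
  let A (u : 'I_k -> 'rV[K]_2) := \matrix_(i < k, j < n.+1) (a i * (veronese n (u i) *m g) 0 j) in
  (forall i, u0 i != 0) -> f.@[mxvec (A u0) 0] != 0 ->
  (forall c (u : 'I_k -> 'rV[K]_2), (forall i, u i != 0) ->
    f.@[mxvec (A u) 0] != 0 -> G.@[sp c u 0] = 0) ->
  forall c (u : 'I_k -> 'rV[K]_2), G.@[sp c u 0] = 0.
Proof.
move=> A u0n fu0 Gf c u.
pose v t i := u0 i + t *: (u i - u0 i).
have vp i l : polynomial_function (fun t => v t i 0 l).
  have [p pE] : polynomial_function (fun t : K => u0 i 0 l + t * (u i - u0 i) 0 l).
    apply: polyfunD; first exact: polyfun_cst.
    by apply: polyfunM; [exact: polyfun_id|exact: polyfun_cst].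
  by exists p => t; rewrite -pE !mxE.
have v0 : v 0 = u0 by apply/funext => i; rewrite /v scale0r addr0.
have v1 : v 1 = u by apply/funext => i; rewrite /v scale1r addrC subrK.
have /choice[l l0] i : exists l, u0 i 0 l != 0.
  apply/existsP; apply: contraR (u0n i) => /existsPn u00.
  by apply/eqP/rowP => j; rewrite mxE; apply/eqP/negbNE/u00.
rewrite -v1.
(* The coordinate [l i] of the i-th point is nonzero at parameter 0; where the product of these
   coordinates is nonzero, so is every point. *)
apply: (@polyfun_eq0 K (fun t => G.@[sp c (v t) 0])
  (fun t => f.@[mxvec (A (v t)) 0] * \prod_(i < k) v t i 0 (l i)) 0).
- apply: polyfun_meval => j.
  have [p pE] : polynomial_function (fun t => \sum_(i < k) c i * (veronese n (v t i) *m g) 0 j).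
    apply: polyfun_sum => i; apply: polyfunM; first exact: polyfun_cst.
    exact: polyfun_veronese.
  exists p => t; rewrite -pE /secant_point mulmx_suml summxE.
  by apply: eq_bigr => i _; rewrite -scalemxAl mxE.
- apply: polyfunM; last by apply: polyfun_prod => i.
  apply: polyfun_meval => ij; case/mxvec_indexP: ij => i j.
  have [p pE] : polynomial_function (fun t => a i * (veronese n (v t i) *m g) 0 j).
    by apply: polyfunM; [exact: polyfun_cst|exact: polyfun_veronese].
  by exists p => t; rewrite -pE mxvecE mxE.
- by rewrite v0 mulf_neq0 //; apply/prodf_neq0 => i _.
- move=> t; rewrite mulf_eq0 negb_or => /andP[ft /prodf_neq0 vt].
  apply: Gf => // i; apply: contraTneq (vt i isT) => ->.
  by rewrite mxE eqxx.
Qed.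

Lemma exists_secant_plane (c : 'I_k -> K) (u : 'I_k -> 'rV[K]_2) :
  (forall i, u i != 0) ->
  exists p : 'I_k -> proj_space K n, [/\ forall i, image_curve (p i),
    forall i, val (p i) = <[veronese n (u i) *m g]>%VS &
    exists2 y, secant_plane p y & sp c u \in val y].
Proof.
move=> u_neq0; have v0 i := image_point_neq0 (u_neq0 i).
pose p i := span_point (v0 i); exists p; split=> // [i|].
  by apply/image_curveP; exists (u i).
have mem : (sp c u \in \sum_(i < k) val (p i))%VS.
  by apply/(memv_secant_plane (u := u)) => //; exists c.
(* The zero vector spans no projective point but lies in every line, so any point of the plane
   serves; [k_gt0] provides one. *)
have [w0|w0] := eqVneq (sp c u) 0.
  exists (p (Ordinal k_gt0)); last by rewrite w0 mem0v.
  exact: (sumv_sup (Ordinal k_gt0)).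
exists (span_point w0); last exact: memv_line.
by rewrite /secant_plane /= -memvE.
Qed.

(** This holds for arbitrary points of the curve, not only general ones: a form vanishing on the
    planes over a nonempty open set vanishes on all of them by [secant_generic]. *)
Lemma secant_plane_sub_variety (p : 'I_k -> proj_space K n) x :
  (forall i, image_curve (p i)) -> secant_plane p x ->
  secant_variety k image_curve x.
Proof.
move=> pC px U [[T ->] [p0 [p0C p0T]]] d G GU w wx.
have /choice[u uP] i : exists u, u != 0 /\ val (p i) = <[veronese n u *m g]>%VS.
  by have /image_curveP[v] := pC i; exists v.
have /choice[u0 u0P] i : exists u, u != 0 /\ val (p0 i) = <[veronese n u *m g]>%VS.
  by have /image_curveP[v] := p0C i; exists v.
have /memv_secant_plane-/(_ u (fun i => (uP i).2))[c ->] : (w \in \sum_(i < k) val (p i))%VS.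
  exact: subvP px _ wx.
(* The point [p0] of the open set yields an equation [f] of the complement that is nonzero at some
   representatives, recorded by the scalars [a]. *)
move: p0T; rewrite /multi_zeros /= => /existsNP[f /not_implyP[Tf /existsNP[A /not_implyP[Ap fA]]]].
have /choice[a aP] i : exists a, row i A = a *: (veronese n (u0 i) *m g).
  by have := Ap i; rewrite (u0P i).2 => /vlineP.
apply: (@secant_generic (val G) f a u0) => [i||c' u' u'0 fu'].
- exact: (u0P i).1.
- apply/eqP; apply: contra_not fA => <-; congr (_.@[_]); congr (mxvec _ _); apply/matrixP => i j.
  by have /rowP/(_ j) := aP i; rewrite !mxE.
have [p' [p'C p'E [y py wy]]] := exists_secant_plane c' u'0.
apply: (GU y) wy; exists p' => //; split=> //.
move=> zp; apply/negP: fu'; apply/negPn/eqP; apply: zp Tf _ _ => i.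
by rewrite p'E; apply/vlineP; exists (a i); apply/rowP => j; rewrite !mxE.
Qed.

Lemma vanishes_on_secant_variety d (F : dhomog n.+1 K d) :
  vanishes_on (val F) (secant_variety k image_curve) <->
  forall c (u : 'I_k -> 'rV[K]_2), (forall i, u i != 0) -> (val F).@[sp c u 0] = 0.
Proof.
split=> [van c u u_neq0|van x secx].
  have [p [pC _ [y py wy]]] := exists_secant_plane c u_neq0.
  by apply: van wy; apply: secant_plane_sub_variety py.
(* The whole power of the curve is an admissible open set: its complement is cut out by the constant
   1. *)
apply: (secx (cartesian_power image_curve) _ d F) => [|y [p pC py] w wy].
  split.
    exists [set 1%R]; apply/seteqP; split=> [p pC|p []//]; split=> //.
    move=> /(_ _ erefl 0) p0.
    have /eqP : (1 : {mpoly K[k * n.+1]}).@[mxvec (0 : 'M_(k, n.+1)) 0] = 0.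
      by apply: p0 => i; rewrite row0 mem0v.
    by rewrite meval1 oner_eq0.
  have one_neq0 : const_mx 1 != 0 :> 'rV[K]_2.
    by apply/eqP => /rowP/(_ 0); rewrite !mxE => /eqP; rewrite oner_eq0.
  by have [p [pC _ _]] := exists_secant_plane (fun=> 0) (fun=> one_neq0); exists p.
have /choice[u uP] i : exists u, u != 0 /\ val (p i) = <[veronese n u *m g]>%VS.
  by have /image_curveP[v] := pC i; exists v.
have /memv_secant_plane-/(_ u (fun i => (uP i).2))[c ->] : (w \in \sum_(i < k) val (p i))%VS.
  exact: subvP py _ wy.
by apply: van => i; apply: (uP i).1.
Qed.

End Geometry.

(** Substitution by g is an automorphism of the space of degree d forms and carries the ideal for C
    onto that for the Veronese curve, so the codimension is the one already computed. *)
Lemma hilbert_function_secant (K : closedFieldType) n k (C : set (proj_space K n)) d :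
  rational_normal_curve C -> (0 < k)%N ->
  hilbert_function (secant_variety k C) d = standard_count n.+1 k d.
Proof.
move=> [g gu ->] k0; rewrite /hilbert_function -/(image_curve g).
set V := vanishing_forms _ _.
have VP F : F \in V <-> forall c (u : 'I_k -> 'rV_2), (forall i, u i != 0) ->
    (val F).@[(secant_point n c u *m g) 0] = 0.
  by rewrite -(vanishes_on_secant_variety gu k0); apply: vanishing_formsP.
pose f := linfun (substitution (d := d) g).
have fK : lker f == 0%VS.
  apply/lker0P => F G; rewrite !lfunE; exact: (can_inj (substitutionK gu)).
rewrite -(codim_secant_ideal (I := (f @: V)%VS) (k := k)).
  by rewrite limg_dim_eq // (eqP fK) capv0.
move=> F; split=> [/memv_imgP[G /VP van ->] c u u0|van].
  by rewrite lfunE /= meval_comp_linear_forms van.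
have FE : F = f (substitution (invmx g) F).
  by rewrite lfunE /= -{1}[F](substitutionK (g := invmx g)) ?unitmx_inv // invmxK.
rewrite FE memv_img //; apply/VP => c u u0.
by rewrite /= meval_comp_linear_forms -mulmxA mulmxV // mulmx1 van.
Qed.

Theorem mainTheorem11 (R : realType) (n : nat)
    (C : set (proj_space R[i] n)) (hC : rational_normal_curve C)
    (k : nat) (hk : (1 <= k <= n./2)%N) :
  series_is_fraction (hilbert_series (secant_variety k C))
    (\sum_(0 <= j < k.+1) ('C(n - 2 * k + j, j)%:R *: 'X^j))
    ((1 - 'X) ^+ (2 * k)).
Proof.
case/andP: hk => k0 kn.
suff -> : hilbert_series (secant_variety k C) = standard_series n.+1 k.
  by apply: standard_series_fraction; rewrite mul2n -(geq_half_double k n).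
by apply/funext => d; rewrite /hilbert_series hilbert_function_secant.
Qed.
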